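(* For every positive integer $n$, $$\mathrm{ex}(n,\mathbf C\mathbf D)=\left\lfloor\tfrac14(n-1)^2\right\rfloor,$$ and a triple system $\mathcal F$ on $n$ vertices containing neither $\mathbf C$ nor $\mathbf D$ attains equality, $|\mathcal F|=\lfloor\frac14(n-1)^2\rfloor$, if and only if it is of the form $\mathcal F_T$ for some tournament $T$.
   Context: A triple system on a finite vertex set $V$, $|V|=n$, is a family $\mathcal F$ of distinct $3$-element subsets (triples) of $V$. We write $123$ for $\{1,2,3\}$ etc. $\mathbf C=\{124,134,234\}$ (on 4 vertices) and $\mathbf D=\{123,134,235\}$ (on 5 vertices). A triple system contains a configuration if some of its triples form a system isomorphic to it (not necessarily induced). $\mathrm{ex}(n,X_1\dots X_k)$ denotes the maximum number of triples in a triple system on $n$ vertices that contains none of $X_1,\dots,X_k$. Tournament construction $\mathcal F_T$: take a maximum size matching (i.e. $\lfloor n/2\rfloor$ pairwise disjoint pairs) in the complete graph on the $n$-element vertex set, and a tournament $T$ whose vertices are these $\lfloor n/2\rfloor$ pairs (for any two distinct pairs exactly one of the two orientations is present). $\mathcal F_T$ consists of all triples $e\cup\{v\}$ where $e$ is a matching pair and $v$ belongs to another matching pair $e'$ such that $T$ has the arc $e\to e'$; and, if $n$ is odd, also all triples $e\cup\{u\}$ where $e$ is a matching pair and $u$ is the unique unmatched vertex. *)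

(* Defs.v *)
From mathcomp Require Import all_boot.

Set Implicit Arguments.
Unset Strict Implicit.
Unset Printing Implicit Defensive.

Definition triple_system (V : finType) (F : {set {set V}}) : bool :=
  [forall t in F, #|t| == 3].

Record configuration := Configuration {
  cfg_order : nat;
  cfg_triples : {set {set 'I_cfg_order}}
}.

(* Not necessarily induced: F may have further triples on the image of f. *)
Definition contains (V : finType) (F : {set {set V}}) (X : configuration)
    : bool :=
  [exists f : {ffun 'I_(cfg_order X) -> V},
     injectiveb f && ([set f @: (t : {set _}) | t in cfg_triples X] \subset F)].

(* Vertices of configurations are labelled from 1, ordinals from 0. *)
Definition vertex n (i : nat) : 'I_n.+1 := inord i.-1.

Definition triple n (i j k : nat) : {set 'I_n.+1} :=
  [set vertex n i; vertex n j; vertex n k].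

Definition confC : configuration :=
  @Configuration 4 [set triple 3 1 2 4; triple 3 1 3 4; triple 3 2 3 4].

Definition confD : configuration :=
  @Configuration 5 [set triple 4 1 2 3; triple 4 1 3 4; triple 4 2 3 5].

Definition avoids (V : finType) (F : {set {set V}}) (Xs : seq configuration)
    : bool :=
  all (fun X => ~~ contains F X) Xs.

Definition exnum (n : nat) (Xs : seq configuration) : nat :=
  \max_(F : {set {set 'I_n}} | triple_system F && avoids F Xs) #|F|.

Definition maximum_matching (V : finType) (M : {set {set V}}) : bool :=
  [&& [forall e in M, #|e| == 2], trivIset M & #|M| == #|V|./2].

(* T is the arc relation; only its restriction to the vertex set M matters. *)
Definition tournament (U : finType) (M : {set U}) (T : rel U) : bool :=
  [forall e in M, ~~ T e e] &&
  [forall e in M, forall e' in M, (e != e') ==> (T e e' (+) T e' e)].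

(* When #|V| is odd, the complement of cover M is the single unmatched
   vertex. *)
Definition tournament_system (V : finType) (M : {set {set V}})
    (T : rel {set V}) : {set {set V}} :=
  (\bigcup_(e in M) \bigcup_(e' in M | (e' != e) && T e e')
      [set v |: e | v in e'])
  :|: (if odd #|V| then [set u |: e | e in M, u in ~: cover M] else set0).

(* Main.v *)
Require Import Defs.
From mathcomp Require Import all_boot zify.

Set Implicit Arguments.
Unset Strict Implicit.
Unset Printing Implicit Defensive.

(** Two of the three pairs of a triple can be chosen so that each lies in a
    further triple exactly when [C] or [D] is present: [C] if the two further
    triples have the same third vertex, [D] if not. So [F] avoids both
    configurations if and only if every triple has at most one pair shared with
    other triples ([avoids_fork], [fork_of_shared]). Choose in each triple a
    base, namely its shared pair if there is one. The two other pairs, its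
    sides, lie in this triple only. Let [G] be the graph of all pairs that are
    not sides. Then every triple contains exactly one edge of [G], its base, and
    every pair outside [G] lies in exactly one triple; such a [G] is called a
    skeleton of [F], and having one is equivalent to avoiding [C] and [D]
    ([avoids_skeleton]).

    Every triple has two sides, and the sides are the pairs outside [G], so
    [2 |F| + |G| = C(n, 2)] ([skeleton_card]). The size of [F] is therefore
    maximal when [G] is smallest, and [G] has at least [floor (n / 2)] edges
    because it leaves at most one vertex isolated, and none if [n] is even:
    - Suppose [v] is isolated in [G]. Every pair [vx] is a side, and [v] is on
      no base, so [v] is the apex of the triple containing [vx]. The bases
      facing [v] thus cut the other [n - 1] vertices into pairs, and [n] is odd
      ([skeleton_isolated_parity]).
    - If [v] and [w] were both isolated, the base of the triple through [vw]
      would have to avoid two of its three vertices ([skeleton_isolated_uniq]).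
    Hence [|F| <= floor ((n - 1)^2 / 4)], with equality if and only if [G] is a
    maximum matching ([skeleton_card_leqif]).

    What remains is that the systems with a skeleton [M] that is a maximum
    matching are the systems [F_T] with matching [M]. That [M] is a skeleton of
    [F_T] is [tournament_system_skeleton]; it also shows that [F_T] avoids the
    two configurations and, with the equality case above, gives its size without
    counting. In the other direction ([matching_skeleton_tournament]), orient
    [e -> e'] when some vertex of [e'] is the apex of a triple on [e]. *)

(** * Skeletons *)

Definition skeleton (V : finType) (F G : {set {set V}}) : Prop :=
  [/\ {in F, forall t : {set V}, #|t| = 3},
      {in G, forall e : {set V}, #|e| = 2},
      {in F, forall t : {set V}, #|[set e in G | e \subset t]| = 1}
    & forall p : {set V}, #|p| = 2 -> p \notin G ->
        #|[set t in F | p \subset t]| = 1].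

Lemma pair_eq (V : finType) (p e : {set V}) :
  #|p| = 2 -> #|e| = 2 -> p \subset e -> p = e.
Proof. by move=> p2 e2 pe; apply/eqP; rewrite eqEcard pe p2 e2. Qed.

Lemma sum_card_pairs (V : finType) (P : {set {set V}}) :
  {in P, forall e : {set V}, #|e| = 2} -> \sum_(e in P) #|e| = #|P|.*2.
Proof. by move=> P2; rewrite -muln2 -sum_nat_const; apply: eq_bigr => e /P2. Qed.

Lemma uncovered_notin (V : finType) (P : {set {set V}}) (e : {set V}) v :
  v \notin cover P -> e \in P -> v \notin e.
Proof. by move=> vP eP; apply: contra vP => ve; apply/bigcupP; exists e. Qed.

Lemma triple_apex (V : finType) (t e : {set V}) v :
  #|t| = 3 -> #|e| = 2 -> e \subset t -> v \in t -> v \notin e -> t = v |: e.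
Proof.
move=> t3 e2 et vt ve; apply/esym/eqP; rewrite eqEcard cardsU1 ve e2 t3 andbT.
by rewrite subUset sub1set vt.
Qed.

Lemma triple_has_apex (V : finType) (t e : {set V}) :
  #|t| = 3 -> #|e| = 2 -> e \subset t -> exists2 v, v \notin e & t = v |: e.
Proof.
move=> t3 e2 et.
have [|v vt ve] := subsetPn (_ : ~~ (t \subset e)).
  by apply: contraTN isT => /subset_leq_card; rewrite t3 e2.
by exists v => //; apply: triple_apex.
Qed.

Lemma pairs_of_triple_meet (V : finType) (t e e' : {set V}) :
  #|t| = 3 -> #|e| = 2 -> #|e'| = 2 -> e \subset t -> e' \subset t ->
  ~~ [disjoint e & e'].
Proof.
move=> t3 e2 e'2 et e't; apply/negP => dis.
have : #|e :|: e'| <= #|t| by rewrite subset_leq_card // subUset et.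
by rewrite cardsU (disjoint_setI0 dis) cards0 t3 e2 e'2.
Qed.

Lemma skeleton_base (V : finType) (F G : {set {set V}}) t :
  skeleton F G -> t \in F -> exists2 e, e \in G & e \subset t.
Proof.
move=> [_ _ sk _] /sk /eqP/cards1P[e /setP/(_ e)].
by rewrite !inE eqxx => /andP[]; exists e.
Qed.

Lemma skeleton_base_uniq (V : finType) (F G : {set {set V}}) (t e e' : {set V}) :
  skeleton F G -> t \in F -> e \in G -> e' \in G ->
  e \subset t -> e' \subset t -> e = e'.
Proof.
move=> [_ _ sk _] /sk/eq_leq/card_le1_eqP uniq eG e'G et e't.
by apply: uniq; rewrite inE ?eG ?e'G.
Qed.

Lemma skeleton_side_uniq (V : finType) (F G : {set {set V}}) (t t' p : {set V}) :
  skeleton F G -> #|p| = 2 -> p \notin G -> t \in F -> t' \in F ->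
  p \subset t -> p \subset t' -> t = t'.
Proof.
move=> [_ _ _ sk] p2 pG tF t'F pt pt'.
by apply: (card_le1_eqP (eq_leq (sk _ p2 pG))); rewrite inE ?tF ?t'F.
Qed.

(** The triple through a side [xy] has its base at one end of the side and its
    apex at the other. *)
Lemma skeleton_side (V : finType) (F G : {set {set V}}) x y :
  skeleton F G -> x != y -> [set x; y] \notin G ->
  exists2 e, e \in G & [/\ x \in e, y \notin e & y |: e \in F]
                    \/ [/\ y \in e, x \notin e & x |: e \in F].
Proof.
move=> sk xy pG; have [F3 G2 _ side] := sk.
have p2 : #|[set x; y]| = 2 by rewrite cards2 xy.
have /eqP/cards1P[t /setP/(_ t)] := side _ p2 pG.
rewrite !inE eqxx subUset !sub1set => /and3P[tF xt yt].
have [e eG et] := skeleton_base sk tF; exists e => //.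
have t3 := F3 _ tF; have e2 := G2 _ eG.
have [xe|xe] := boolP (x \in e); [left | right].
  have ye : y \notin e.
    apply: contra pG => ye.
    by rewrite (pair_eq p2 e2) // subUset !sub1set xe.
  by rewrite -(triple_apex t3 e2 et yt ye).
have tE := triple_apex t3 e2 et xt xe; rewrite -tE; split=> //.
by move: yt; rewrite tE !inE eq_sym (negPf xy).
Qed.

(** Count the incidences between triples and pairs outside [G]: each triple
    contains two such pairs, and each such pair lies in one triple. *)
Lemma skeleton_card (V : finType) (F G : {set {set V}}) :
  skeleton F G -> #|F|.*2 + #|G| = 'C(#|V|, 2).
Proof.
move=> [F3 G2 base side].
pose sides := [set p : {set V} | #|p| == 2] :\: G.
have GS : G \subset [set p : {set V} | #|p| == 2].
  by apply/subsetP => e /G2/eqP; rewrite inE.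
have count (T : finType) (A : {set T}) (b : pred T) :
    \sum_(x in A) b x = #|[set x in A | b x]|.
  rewrite -sum1dep_card big_mkcondr; apply: eq_bigr => x _.
  by case: (b x).
have : \sum_(t in F) \sum_(p in sides) (p \subset t) = #|F|.*2.
  rewrite -muln2 -sum_nat_const; apply: eq_bigr => t tF; rewrite count.
  have -> : [set p in sides | p \subset t] =
    [set p : {set V} | p \subset t & #|p| == 2] :\: [set e in G | e \subset t].
    apply/setP => p; rewrite !inE.
    by case: (p \in G); case: (p \subset t); case: (_ == _).
  rewrite cardsD (setIidPr _) ?cards_draws ?(F3 t tF) ?(base t tF) //.
  by apply/subsetP => p; rewrite !inE => /andP[/G2-> ->].
rewrite exchange_big /= => <-.
have -> : \sum_(p in sides) \sum_(t in F) (p \subset t) = \sum_(p in sides) 1.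
  apply: eq_bigr => p; rewrite !inE => /andP[pG /eqP p2].
  by rewrite count side.
rewrite sum1_card cardsD (setIidPr GS) card_draws subnK //.
by rewrite -card_draws subset_leq_card.
Qed.

(** The edges of [G] that form a triple with the isolated vertex [v] partition
    the other vertices into pairs: [x] lies on the base of the triple through
    the side [vx], and on no other because that triple is unique. *)
Lemma skeleton_isolated_parity (V : finType) (F G : {set {set V}}) v :
  skeleton F G -> v \notin cover G -> odd #|V|.
Proof.
move=> sk vG; have [F3 G2 _ _] := sk.
have vnot e : e \in G -> v \notin e by apply: uncovered_notin.
have vpair x : [set v; x] \notin G.
  by apply/negP => /vnot; rewrite !inE eqxx.
pose P := [set e in G | v |: e \in F].
have P2 : {in P, forall e : {set V}, #|e| = 2} by move=> e; rewrite inE => /andP[/G2].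
suff /(card_uniform_partition P2) : partition P (~: [set v]).
  have : 0 < #|V| by apply/card_gt0P; exists v.
  by rewrite cardsCs setCK cards1; lia.
apply/and3P; split.
- rewrite eqEsubset; apply/andP; split.
    apply/bigcupsP => e; rewrite inE => /andP[eG _]; apply/subsetP => x xe.
    by rewrite !inE; apply: contraTneq xe => ->; apply: vnot.
  apply/subsetP => x; rewrite !inE => xv; apply/bigcupP.
  have vx : v != x by rewrite eq_sym.
  have [e eG [[ve _ _] | [xe _ tF]]] := skeleton_side sk vx (vpair x).
    by move: (vnot _ eG); rewrite ve.
  by exists e; rewrite // inE eG.
- apply/trivIsetP => e e'; rewrite !inE => /andP[eG tF] /andP[e'G t'F].
  apply: contra_neqT => /pred0Pn[x /andP[/= xe xe']].
  have xv : v != x by apply: contraTneq xe => <-; apply: vnot.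
  rewrite -(setU1K (vnot _ eG)) -(setU1K (vnot _ e'G)); congr (_ :\ v).
  apply: (skeleton_side_uniq sk _ (vpair x)); rewrite ?cards2 ?xv //.
    by rewrite subUset !sub1set !inE eqxx xe orbT.
  by rewrite subUset !sub1set !inE eqxx xe' orbT.
- by rewrite inE; apply/negP => /andP[/G2]; rewrite cards0.
Qed.

(** A side has an end on the base of its triple, so its two ends cannot both be
    isolated. *)
Lemma skeleton_isolated_uniq (V : finType) (F G : {set {set V}}) :
  skeleton F G -> #|~: cover G| <= 1.
Proof.
move=> sk; apply/card_le1_eqP => v w; rewrite !inE => vG wG.
apply/eqP; apply: contraT => wv.
have vw : v != w by rewrite eq_sym.
have pG : [set v; w] \notin G.
  by apply/negP => /(uncovered_notin vG); rewrite !inE eqxx.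
have [e eG [[ve _ _]|[we _ _]]] := skeleton_side sk vw pG.
  by move: (uncovered_notin vG eG); rewrite ve.
by move: (uncovered_notin wG eG); rewrite we.
Qed.

(** * The bound *)

Lemma skeleton_cover_ge (V : finType) (F G : {set {set V}}) :
  skeleton F G -> #|V|./2.*2 <= #|cover G|.
Proof.
move=> sk; have := skeleton_isolated_uniq sk; rewrite cardsCs setCK.
have [/eqP|] := eqVneq (~: cover G) set0.
  rewrite -cards_eq0 cardsCs setCK; lia.
by case/set0Pn => v; rewrite inE => /(skeleton_isolated_parity sk); lia.
Qed.

(** This identity turns [skeleton_card] into the bound, and it absorbs the case
    distinction on the parity of [n]. *)
Lemma bin2_half_square n : ((n.-1 ^ 2) %/ 4).*2 + n./2 = 'C(n, 2).
Proof.
case: n => // n; rewrite bin2 /= -(odd_double_half n); set m := n./2.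
case: (odd n) => /=; rewrite ?add0n ?add1n.
  have -> : m.*2.+1 ^ 2 = (m * m + m) * 4 + 1 by lia.
  by rewrite divnMDl // addn0; lia.
have -> : m.*2 ^ 2 = m * m * 4 by lia.
by rewrite mulnK //; lia.
Qed.

(** By [skeleton_card], [F] is extremal exactly when [G] has [#|V|./2] edges.
    Then [G] has just enough endpoints to cover what it must cover, so no two
    edges share one. *)
Lemma skeleton_card_leqif (V : finType) (F G : {set {set V}}) :
  skeleton F G -> #|F| <= (#|V|.-1 ^ 2) %/ 4 ?= iff maximum_matching G.
Proof.
move=> sk; have [_ G2 _ _] := sk.
have G2b : [forall e in G, #|e| == 2] by apply/'forall_in_eqP.
have := leq_card_cover G.
rewrite (sum_card_pairs G2) => -[ub ubE]; have lb := skeleton_cover_ge sk.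
have cF := skeleton_card sk; have := bin2_half_square #|V|.
rewrite -cF /maximum_matching G2b -ubE /=.
move: ub lb; set N := _ %/ 4; set h := _./2.
move: #|cover G| #|G| #|F| => c g f ub lb eqn.
split; first by clear -ub lb eqn; lia.
by apply/eqP/andP => [fN|[/eqP cE /eqP gE]]; [split; apply/eqP|]; lia.
Qed.

(** * Tournament systems *)

Lemma block_uniq (V : finType) (M : {set {set V}}) (e e' : {set V}) x :
  trivIset M -> e \in M -> e' \in M -> x \in e -> x \in e' -> e = e'.
Proof. by move=> tM eM e'M /(def_pblock tM eM) <- /(def_pblock tM e'M). Qed.

(** A description that does not depend on parity. If the apex [v] is unmatched,
    the condition on [T] holds vacuously, and [#|V|] is odd because the matching
    misses a vertex. *)
Lemma mem_tournament_system (V : finType) (M : {set {set V}}) T (t : {set V}) :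
  maximum_matching M ->
  t \in tournament_system M T <->
  exists e v, [/\ e \in M, v \notin e, t = v |: e
                & {in M, forall e' : {set V}, v \in e' -> T e e'}].
Proof.
case/and3P => /'forall_in_eqP M2 tM /eqP cM; split.
  rewrite inE => /orP[/bigcupP[e eM /bigcupP[e' /and3P[e'M ee' Tee']]]|].
    case/imsetP => v ve' ->.
    exists e, v; split=> //.
      by apply: contra ee' => ve; rewrite (block_uniq tM eM e'M ve ve').
    by move=> e'' e''M ve''; rewrite (block_uniq tM e''M e'M ve'' ve').
  case: ifP => _; last by rewrite inE.
  case/imset2P => e v eM; rewrite inE => /bigcupP vM ->; exists e, v; split=> //.
    by apply/negP => ve; apply: vM; exists e.
  by move=> e' e'M ve'; case: vM; exists e'.
case=> e [v [eM ve -> Tv]]; rewrite inE.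
have [/bigcupP[e' e'M ve']|vM] := boolP (v \in cover M); apply/orP; [left|right].
  apply/bigcupP; exists e => //; apply/bigcupP; exists e'.
    by rewrite e'M Tv // andbT; apply: contraNneq ve => <-.
  exact: imset_f.
have -> : odd #|V|.
  have : #|cover M| < #|V|.
    rewrite -cardsT; apply: proper_card; rewrite properT.
    by apply: contraNneq vM => ->.
  have -> : #|cover M| = #|M|.*2 by rewrite -(eqP tM) sum_card_pairs.
  lia.
by apply/imset2P; exists e v; rewrite ?inE.
Qed.

Lemma tournament_asym (U : finType) (M : {set U}) (T : rel U) e e' :
  tournament M T -> e \in M -> e' \in M -> e != e' -> T e e' = ~~ T e' e.
Proof.
case/andP => _ /forall_inP tot eM e'M ee'.
have /forall_inP/(_ e' e'M)/implyP/(_ ee') := tot _ eM.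
by case: (T e e'); case: (T e' e).
Qed.

Lemma uncovered_uniq (V : finType) (M : {set {set V}}) :
  maximum_matching M -> #|~: cover M| <= 1.
Proof.
case/and3P => /'forall_in_eqP M2 /eqP covE /eqP cM; rewrite cardsCs setCK.
by rewrite -covE sum_card_pairs // cM; lia.
Qed.

(** A triple has room for one edge of a matching, which gives its base. A pair
    outside [M] joins two matching edges, and it lies in the one triple given by
    the arc between them, or it joins an edge to the unmatched vertex. *)
Lemma tournament_system_skeleton (V : finType) (M : {set {set V}}) T :
  maximum_matching M -> tournament M T -> skeleton (tournament_system M T) M.
Proof.
move=> mM tT; have [/'forall_in_eqP M2 tM _] := and3P mM.
have memP t := mem_tournament_system T t mM.
have F3 : {in tournament_system M T, forall t : {set V}, #|t| = 3}.
  by move=> t /memP[e [v [eM ve -> _]]]; rewrite cardsU1 ve M2.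
have base_uniq (t e e' : {set V}) : #|t| = 3 -> e \in M -> e' \in M ->
    e \subset t -> e' \subset t -> e = e'.
  move=> t3 eM e'M et e't.
  have := pairs_of_triple_meet t3 (M2 _ eM) (M2 _ e'M) et e't.
  case/pred0Pn => x /andP[/= xe xe'].
  exact: block_uniq tM eM e'M xe xe'.
split=> // [t tF|p p2 pM].
  have /memP[e [v [eM ve tE _]]] := tF.
  apply/eqP/cards1P; exists e; apply/setP => e'; rewrite !inE.
  have et : e \subset t by rewrite tE subsetUr.
  apply/andP/eqP => [[e'M e't]|-> //]; exact: base_uniq (F3 _ tF) e'M eM e't et.
apply/anti_leq/andP; split.
  apply/card_le1_eqP => t t' /setIdP[tF pt] /setIdP[t'F pt'].
  have /memP[e [v [eM ve tE Tv]]] := tF.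
  have /memP[e' [v' [e'M ve' tE' Tv']]] := t'F.
  (* A pair outside M that lies in w |: f is the apex w and an end of f. *)
  have side w (f : {set V}) : f \in M -> w \notin f -> p \subset w |: f ->
      exists2 a, a \in f & p = [set w; a].
    move=> fM wf pf.
    have wp : w \in p.
      apply: contraR pM => wp.
      by rewrite (pair_eq p2 (M2 _ fM)) // -(setU1K wf) subsetD1 pf.
    have /cards1P[a pa] : #|p :\ w| == 1.
      by have := cardsD1 w p; rewrite wp p2 add1n => -[<-].
    have pE : p = [set w; a] by rewrite -(setD1K wp) pa.
    have ap : a \in p :\ w by rewrite pa inE.
    exists a => //; move: ap; rewrite !inE => /andP[/negPf aw ap].
    by move/subsetP: pf => /(_ a ap); rewrite !inE aw.
  rewrite tE in pt; rewrite tE' in pt'.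
  have [a ae pE] := side _ _ eM ve pt; have [a' ae' pE'] := side _ _ e'M ve' pt'.
  have [vv|vv] := eqVneq v v'.
    have aa : a = a'.
      have : a \in p by rewrite pE !inE eqxx orbT.
      rewrite pE' -vv !inE => /orP[/eqP av|/eqP //].
      by rewrite -av ae in ve.
    by rewrite tE tE' -vv (block_uniq tM eM e'M ae) // aa.
  (* The two triples would use the pair in opposite directions, which needs
     both arcs between e and e'. *)
  have va : v = a'.
    have : v \in p by rewrite pE !inE eqxx.
    by rewrite pE' !inE (negPf vv) => /eqP.
  have v'a : v' = a.
    have : v' \in p by rewrite pE' !inE eqxx.
    by rewrite pE !inE eq_sym (negPf vv) => /eqP.
  have ee' : e != e' by apply: contraNneq ve => ->; rewrite va.
  have := tournament_asym tT eM e'M ee'.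
  by rewrite Tv ?va // Tv' // v'a.
have /cards2P[x [y [xy pE]]] : #|p| == 2 by rewrite p2.
have add (e : {set V}) a b : p = [set a; b] -> e \in M -> a \in e ->
    {in M, forall e' : {set V}, b \in e' -> T e e'} ->
    0 < #|[set t in tournament_system M T | p \subset t]|.
  move=> pab eM ae Tb; apply/card_gt0P; exists (b |: e).
  apply/setIdP; split; last by rewrite pab subUset !sub1set !inE eqxx ae orbT.
  apply/memP; exists e, b; split=> //; apply: contra pM => be.
  by rewrite (pair_eq p2 (M2 _ eM)) // pab subUset !sub1set ae.
have pE' : p = [set y; x] by rewrite setUC.
have [/bigcupP[e eM xe]|xM] := boolP (x \in cover M); last first.
  have [/bigcupP[e eM ye]|yM] := boolP (y \in cover M).
    by apply: (add e y x) => // e' e'M xe'; case/bigcupP: xM; exists e'.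
  move/card_le1_eqP: (uncovered_uniq mM) => /(_ x y); rewrite !inE.
  by move=> /(_ xM yM) eqxy; rewrite eqxy eqxx in xy.
have [/bigcupP[e' e'M ye']|yM] := boolP (y \in cover M); last first.
  by apply: (add e x y) => // e' e'M ye'; case/bigcupP: yM; exists e'.
have ee' : e != e'.
  apply: contraNneq pM => eq_e.
  by rewrite (pair_eq p2 (M2 _ eM)) // pE subUset !sub1set xe eq_e.
have [Tee'|] := boolP (T e e').
  by apply: (add e x y) => // f fM yf; rewrite (block_uniq tM fM e'M yf).
rewrite (tournament_asym tT) // negbK => Te'e.
by apply: (add e' y x) => // f fM xf; rewrite (block_uniq tM fM eM xf).
Qed.

(** Let [e] and [e'] be distinct edges of [M]. A triple with base [e] and apex on
    [e'] and a triple with base [e'] and apex on [e] cannot both occur, as they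
    would share the side joining the two apices. So all four sides between [e] and [e'] belong to triples with
    the same base: this makes the relation a tournament, and it shows that every
    vertex of [e'] is an apex over [e] as soon as one is. *)
Lemma matching_skeleton_tournament (V : finType) (F M : {set {set V}}) :
  skeleton F M -> maximum_matching M ->
  exists2 T, tournament M T & F = tournament_system M T.
Proof.
move=> sk mM; have [/'forall_in_eqP M2 tM _] := and3P mM.
have [F3 _ _ _] := sk.
pose T (e e' : {set V}) := [exists v in e', v |: e \in F].
have cross (e : {set V}) a v :
    e \in M -> a \in e -> v \notin e -> [set v; a] \notin M.
  move=> eM ae; apply: contra => pM.
  by rewrite -(block_uniq tM pM eM (x := a)) ?inE ?eqxx ?orbT.
have neq (e : {set V}) a v : a \in e -> v \notin e -> v != a.
  by move=> ae; apply: contraNneq => ->.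
have disj e e' x : e \in M -> e' \in M -> e != e' -> x \in e' -> x \notin e.
  move=> eM e'M ee' xe'; apply: contra ee' => xe.
  by rewrite (block_uniq tM eM e'M xe xe').
have point e : e \in M -> exists a, a \in e.
  by move=> eM; apply/card_gt0P; rewrite M2.
have asym e e' v w : e \in M -> e' \in M -> e != e' -> v \in e' -> w \in e ->
    v |: e \in F -> w |: e' \in F -> False.
  move=> eM e'M ee' ve' we tF t'F; have ve := disj _ _ _ eM e'M ee' ve'.
  have p2 : #|[set v; w]| = 2 by rewrite cards2 (neq e).
  have tt' : v |: e = w |: e'.
    apply: (skeleton_side_uniq sk p2 (cross _ _ _ eM we ve) tF t'F);
    by rewrite subUset !sub1set !inE eqxx ?we ?ve' ?orbT.
  case/eqP: ee'; apply: (skeleton_base_uniq sk tF eM e'M); first exact: subsetUr.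
  by rewrite tt' subsetUr.
exists T.
  apply/andP; split; apply/forall_inP => e eM.
    apply/negP => /exists_inP[v ve /F3].
    by rewrite (setUidPr _) ?sub1set // M2.
  apply/forall_inP => e' e'M; apply/implyP => ee'.
  have [a ae] := point _ eM; have [v ve'] := point _ e'M.
  have ve := disj _ _ _ eM e'M ee' ve'.
  have tot : T e e' || T e' e.
    have [f fM] := skeleton_side sk (neq _ _ _ ae ve) (cross _ _ _ eM ae ve).
    case=> [[vf _ tF]|[af _ tF]]; apply/orP; [right|left].
      by apply/exists_inP; exists a; rewrite // (block_uniq tM e'M fM ve' vf).
    by apply/exists_inP; exists v; rewrite // (block_uniq tM eM fM ae af).
  suff : ~~ (T e e' && T e' e) by move: tot; case: (T e e'); case: (T e' e).
  apply/negP => /andP[/exists_inP[x xe' tF] /exists_inP[y ye t'F]].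
  exact: asym eM e'M ee' xe' ye tF t'F.
apply/setP => t; apply/idP/idP => [tF|/(mem_tournament_system T t mM)].
  apply/(mem_tournament_system T t mM).
  have [e eM et] := skeleton_base sk tF.
  have [v ve tE] := triple_has_apex (F3 _ tF) (M2 _ eM) et.
  exists e, v; split=> // e' _ ve'.
  by apply/exists_inP; exists v; rewrite -?tE.
case=> e [v [eM ve -> Tv]]; have [a ae] := point _ eM.
have [f fM] := skeleton_side sk (neq _ _ _ ae ve) (cross _ _ _ eM ae ve).
case=> [[vf af t'F]|[af _]]; last by rewrite (block_uniq tM eM fM ae af).
have ef : e != f by apply: contraNneq ve => ->.
have /exists_inP[w wf tF] := Tv _ fM vf.
by case: (asym _ _ _ _ eM fM ef wf ae tF t'F).
Qed.

(** * Forbidden configurations *)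

(** The common pattern of [C] and [D]: the pairs [ac] and [bc] of the triple [abc]
    extend to further triples. It is [C] when [x = y] and [D] otherwise. *)
Definition fork (V : finType) (F : {set {set V}}) : Prop :=
  exists a b c x y,
    [/\ uniq [:: a; b; c; x], uniq [:: a; b; c; y], [set a; b; c] \in F,
        [set a; c; x] \in F & [set b; c; y] \in F].

Lemma imset_triple (V : finType) n (f : 'I_n.+1 -> V) i j k :
  f @: triple n i j k = [set f (vertex n i); f (vertex n j); f (vertex n k)].
Proof. by rewrite /triple !imsetU !imset_set1. Qed.

(** A copy of a configuration is conveniently given by the list of the images of
    its vertices. *)
Lemma contains_labelling (V : finType) (F : {set {set V}}) n
    (X : {set {set 'I_n.+1}}) (s : seq V) a :
  size s = n.+1 -> uniq s ->
  {in X, forall t : {set 'I_n.+1}, [set nth a s (nat_of_ord i) | i in t] \in F} ->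
  contains F (Configuration X).
Proof.
move=> sz us sub; apply/existsP; exists [ffun i : 'I_n.+1 => nth a s i].
apply/andP; split.
  apply/injectiveP => i j; rewrite !ffunE => /eqP.
  by rewrite nth_uniq ?sz ?ltn_ord // => /eqP/val_inj.
apply/subsetP => _ /imsetP[t tX ->].
rewrite (eq_imset _ (_ : _ =1 fun i : 'I_n.+1 => nth a s i)) ?sub //.
by move=> i; rewrite ffunE.
Qed.

Lemma contains_triples (V : finType) (F : {set {set V}}) n
    (X : {set {set 'I_n.+1}}) :
  contains F (Configuration X) ->
  exists2 f : 'I_n.+1 -> V, injective f &
    {in X, forall t : {set 'I_n.+1}, f @: t \in F}.
Proof.
case/existsP => f /andP[/injectiveP injf /subsetP sub]; exists f => // t tX.
by apply: sub; apply: imset_f.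
Qed.

Lemma avoids_fork (V : finType) (F : {set {set V}}) :
  avoids F [:: confC; confD] <-> ~ fork F.
Proof.
rewrite /avoids /= andbT; split.
  case/andP => /negP nC /negP nD [a [b [c [x [y [ux uy tF sF s'F]]]]]].
  have [xy|xy] := eqVneq x y.
    (* In C the vertex 4 lies in all three triples; its image is c. *)
    apply: nC; apply: (contains_labelling (s := [:: a; b; x; c]) (a := a)) => //.
      rewrite (perm_uniq (s2 := [:: a; b; c; x])) //.
      by apply/permP => p /=; rewrite (addnCA (p x)).
    move=> t; rewrite !inE => /orP[/orP[]|] /eqP->;
      rewrite imset_triple /vertex /= !inordK //=.
      by rewrite setUAC.
    by rewrite setUAC xy.
  apply: nD.
  apply: (contains_labelling (s := [:: a; b; c; x; y]) (a := a)) => //.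
    move: ux uy; rewrite /= !inE !negb_or xy.
    move=> /and4P[/and3P[-> -> ->] /andP[-> ->] -> _].
    by move=> /and4P[/and3P[_ _ ->] /andP[_ ->] -> _].
  by move=> t; rewrite !inE => /orP[/orP[]|] /eqP->;
    rewrite imset_triple /vertex /= !inordK.
move=> nofork; apply/andP; split;
  apply/negP => /contains_triples[f injf sub]; apply: nofork.
  pose v i := vertex 3 i.
  exists (f (v 1)), (f (v 2)), (f (v 4)), (f (v 3)), (f (v 3)).
  have u : uniq [:: f (v 1); f (v 2); f (v 4); f (v 3)].
    rewrite (map_inj_uniq injf [:: v 1; v 2; v 4; v 3]).
    by rewrite /= !inE -!val_eqE /= !inordK.
  split=> //; first by rewrite -imset_triple sub // !inE eqxx.
    by rewrite setUAC -imset_triple sub // !inE eqxx ?orbT.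
  by rewrite setUAC -imset_triple sub // !inE eqxx ?orbT.
pose v i := vertex 4 i.
exists (f (v 1)), (f (v 2)), (f (v 3)), (f (v 4)), (f (v 5)).
have u (s : seq 'I_5) : uniq s -> uniq (map f s) by rewrite map_inj_uniq.
split; try by rewrite -imset_triple sub // !inE eqxx ?orbT.
  apply: (u [:: v 1; v 2; v 3; v 4]).
  by rewrite /= !inE -!val_eqE /= !inordK.
apply: (u [:: v 1; v 2; v 3; v 5]).
by rewrite /= !inE -!val_eqE /= !inordK.
Qed.

(** Both extended pairs of a fork lie in two triples, so they belong to the
    skeleton; but a triple contains only one edge of it. *)
Lemma skeleton_no_fork (V : finType) (F G : {set {set V}}) :
  skeleton F G -> ~ fork F.
Proof.
move=> sk [a [b [c [x [y [ux uy tF sF s'F]]]]]].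
move: ux uy; rewrite /= !inE !negb_or.
move=> /and4P[/and3P[ab ac ax] /andP[bc bx] cx _].
move=> /and4P[/and3P[_ _ ay] _ _ _].
have acG : [set a; c] \in G.
  apply: contraT => nG; have p2 : #|[set a; c]| = 2 by rewrite cards2 ac.
  suff /setP/(_ b) : [set a; b; c] = [set a; c; x].
    by rewrite !inE eqxx orbT (negPf bc) (negPf bx) [b == a]eq_sym (negPf ab).
  apply: (skeleton_side_uniq sk p2 nG) => //;
  by rewrite subUset !sub1set !inE !eqxx ?orbT.
have bcG : [set b; c] \in G.
  apply: contraT => nG; have p2 : #|[set b; c]| = 2 by rewrite cards2 bc.
  suff /setP/(_ a) : [set a; b; c] = [set b; c; y].
    by rewrite !inE eqxx (negPf ab) (negPf ac) (negPf ay).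
  apply: (skeleton_side_uniq sk p2 nG) => //;
  by rewrite subUset !sub1set !inE !eqxx ?orbT.
have /setP/(_ a) : [set a; c] = [set b; c].
  apply: (skeleton_base_uniq sk tF) => //;
  by rewrite subUset !sub1set !inE !eqxx ?orbT.
by rewrite !inE eqxx (negPf ab) (negPf ac).
Qed.

Definition shared (V : finType) (F : {set {set V}}) (t p : {set V}) : bool :=
  [exists t' in F, (p \subset t') && (t' != t)].

(** Two distinct pairs of a triple meet in a vertex, which becomes the vertex [c]
    of the fork. *)
Lemma fork_of_shared (V : finType) (F : {set {set V}}) (t e p : {set V}) :
  triple_system F -> t \in F -> #|e| = 2 -> #|p| = 2 -> e \subset t ->
  p \subset t -> e != p -> shared F t e -> shared F t p -> fork F.
Proof.
move=> /'forall_in_eqP F3 tF e2 p2 et pt ep.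
case/exists_inP => s sF /andP[es st] /exists_inP[s' s'F /andP[ps' s't]].
have t3 := F3 _ tF.
have /pred0Pn[c /andP[/= ce cp]] := pairs_of_triple_meet t3 e2 p2 et pt.
have ptE (q q' : {set V}) : #|q| = 2 -> #|q'| = 2 -> q != q' -> c \in q -> c \in q' ->
    exists a, [/\ a != c, a \notin q' & q = [set a; c]].
  move=> q2 q'2 qq' cq cq'; have [|a aq aq'] := subsetPn (_ : ~~ (q \subset q')).
    by apply: contra qq' => sub; rewrite (pair_eq q2 q'2 sub).
  have ac : a != c by apply: contraNneq aq' => ->.
  exists a; split=> //; apply/esym/pair_eq; rewrite ?cards2 ?ac //.
  by rewrite subUset !sub1set aq.
have pe : p != e by rewrite eq_sym.
have [a [ac ap eE]] := ptE _ _ e2 p2 ep ce cp.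
have [b [bc be pE]] := ptE _ _ p2 e2 pe cp ce.
have bt : b \in t by apply: (subsetP pt); rewrite pE !inE eqxx.
have at_ : a \in t by apply: (subsetP et); rewrite eE !inE eqxx.
have [x xe sE] := triple_has_apex (F3 _ sF) e2 es.
have [y yp s'E] := triple_has_apex (F3 _ s'F) p2 ps'.
have tE : t = b |: e by apply: triple_apex.
have tE' : t = a |: p by apply: triple_apex.
have xb : x != b by apply: contraNneq st => xb; rewrite sE tE xb.
have ya : y != a by apply: contraNneq s't => ya; rewrite s'E tE' ya.
exists a, b, c, x, y.
move: xe yp ap; rewrite eE pE !inE !negb_or.
move=> /andP[xa xc] /andP[yb yc] /andP[ab _]; split.
- by rewrite /= !inE !negb_or ab ac bc eq_sym xa eq_sym xb eq_sym xc.
- by rewrite /= !inE !negb_or ab ac bc eq_sym ya eq_sym yb eq_sym yc.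
- by rewrite -setUA -pE -tE'.
- by rewrite setUC -eE -sE.
by rewrite setUC -pE -s'E.
Qed.

(** The base of a triple is its shared pair if it has one, and an arbitrary pair
    if it has none; the skeleton consists of the pairs that are a side of no
    triple. In particular it contains the pairs that lie in no triple. *)
Lemma skeleton_of_no_fork (V : finType) (F : {set {set V}}) :
  triple_system F -> ~ fork F -> exists G, skeleton F G.
Proof.
move=> tsF nofork; have /'forall_in_eqP F3 := tsF.
pose is_base (t e : {set V}) := t \in F ->
  [/\ #|e| = 2, e \subset t &
      forall p : {set V}, #|p| = 2 -> p \subset t -> shared F t p -> p = e].
have [b bP] : exists b : {set V} -> {set V}, forall t, is_base t (b t).
  apply: fin_all_exists => t; rewrite /is_base.
  have [tF|] := boolP (t \in F); last by exists set0.
  have [/exists_inP[e /andP[/eqP e2 et] he]|light] := boolP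
      [exists (e : {set V} | (#|e| == 2) && (e \subset t)), shared F t e].
    exists e => _; split=> // p p2 pt hp; apply/eqP; apply: contraT => pe.
    by case: nofork; apply: (fork_of_shared tsF tF p2 e2).
  have [x xt] : exists x, x \in t by apply/card_gt0P; rewrite F3.
  exists (t :\ x) => _; split; last 1 first.
  - move=> p p2 pt hp; case/negP: light; apply/exists_inP; exists p => //.
    by rewrite p2 eqxx.
  - by have := cardsD1 x t; rewrite xt F3 // add1n => -[<-].
  exact: subD1set.
pose side (p : {set V}) := [exists t in F, (p \subset t) && (p != b t)].
exists [set p : {set V} | (#|p| == 2) && ~~ side p].
(* A base is not a side of another triple either: it would be a shared pair of
   that triple, hence its base. *)
have nside t : t \in F -> ~~ side (b t).
  move=> tF; have [b2 bt _] := bP _ tF.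
  apply/exists_inP => -[t' t'F /andP[bt' ne]]; have [_ _ sharedE] := bP _ t'F.
  case/eqP: (ne); apply: sharedE => //; apply/exists_inP; exists t => //.
  by rewrite bt; apply: contraNneq ne => ->.
split=> //.
- by move=> e; rewrite inE => /andP[/eqP].
- move=> t tF; have [b2 bt _] := bP _ tF; apply/eqP/cards1P; exists (b t).
  apply/setP => p; rewrite !inE; apply/andP/eqP => [[/andP[_ sp] pt]|->].
    apply/eqP; apply: contraNT sp => pb; apply/exists_inP; exists t => //.
    by rewrite pt.
  by rewrite b2 eqxx nside.
move=> p p2; rewrite inE p2 eqxx negbK /= => /exists_inP[t tF /andP[pt pb]].
apply/eqP/cards1P; exists t; apply/setP => t'; rewrite !inE.
apply/andP/eqP => [[t'F pt']|-> //]; apply/eqP; apply: contraNT pb => tt'.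
have [_ _ sharedE] := bP _ tF; apply/eqP/sharedE => //.
by apply/exists_inP; exists t'; rewrite // pt'.
Qed.

Lemma avoids_skeleton (V : finType) (F : {set {set V}}) :
  triple_system F ->
  avoids F [:: confC; confD] <-> exists G, skeleton F G.
Proof.
move=> tsF; split=> [/avoids_fork|[G /skeleton_no_fork /avoids_fork //]].
exact: skeleton_of_no_fork.
Qed.

(** * Existence of tournament systems *)

Lemma matching_exists (V : finType) k (A : {set V}) :
  k.*2 <= #|A| ->
  exists M : {set {set V}}, [/\ {in M, forall e : {set V}, #|e| = 2},
    trivIset M, #|M| = k & cover M \subset A].
Proof.
elim: k A => [|k IH] A kA.
  exists set0; split; rewrite ?cards0 //; first by move=> e; rewrite inE.
    by apply/trivIsetP => e e'; rewrite inE.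
  by apply/bigcupsP => e; rewrite inE.
have /card_gt1P[x [y [xA yA xy]]] : 1 < #|A| by rewrite doubleS in kA; lia.
have eA : [set x; y] \subset A by rewrite subUset !sub1set xA.
have [|M [M2 tM cM MA]] := IH (A :\: [set x; y]).
  by rewrite cardsD (setIidPr eA) cards2 xy; rewrite doubleS in kA; lia.
have disj : {in M, forall e : {set V}, [disjoint [set x; y] & e]}.
  move=> e eM; rewrite disjoint_sym disjoints_subset.
  apply: subset_trans (bigcup_sup e eM) (subset_trans MA _).
  by rewrite setDE subsetIr.
have M0 : set0 \notin M by apply/negP => /M2; rewrite cards0.
have [tM' eM] := trivIsetU1 disj tM M0.
exists ([set x; y] |: M); split=> //.
- by move=> e /setU1P[->|/M2 //]; rewrite cards2 xy.
- by rewrite cardsU1 eM cM.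
rewrite /cover bigcup_setU big_set1 subUset eA /=.
by apply: subset_trans MA _; apply: subsetDl.
Qed.

Lemma tournament_exists (U : finType) (M : {set U}) : exists T, tournament M T.
Proof.
exists (fun e e' => enum_rank e < enum_rank e'); apply/andP; split.
  by apply/forall_inP => e _; rewrite ltnn.
apply/forall_inP => e _; apply/forall_inP => e' _; apply/implyP.
rewrite -(inj_eq enum_rank_inj) -val_eqE /=.
by case: ltngtP.
Qed.

Theorem theorem8 (n : nat) (n_gt0 : 0 < n) :
  exnum n [:: confC; confD] = (n.-1 ^ 2) %/ 4 /\
  (forall (V : finType) (F : {set {set V}}),
     #|V| = n -> triple_system F -> avoids F [:: confC; confD] ->
     (#|F| = (n.-1 ^ 2) %/ 4 <->
      exists (M : {set {set V}}) (T : rel {set V}),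
        [/\ maximum_matching M, tournament M T
          & F = tournament_system M T])).
Proof.
split=> [|V F <- tsF /(avoids_skeleton tsF)[G sk]]; last first.
  split=> [/eqP|[M [T [mM tT ->]]]].
    rewrite (skeleton_card_leqif sk) => mG.
    by have [T] := matching_skeleton_tournament sk mG; exists G, T.
  by apply/eqP; rewrite (skeleton_card_leqif (tournament_system_skeleton mM tT)).
apply/anti_leq/andP; split.
  apply/bigmax_leqP => F /andP[tsF /(avoids_skeleton tsF)[G sk]].
  by have [] := skeleton_card_leqif sk; rewrite card_ord.
have [M [M2 tM cM _]] : exists M : {set {set 'I_n}},
    [/\ {in M, forall e : {set 'I_n}, #|e| = 2}, trivIset M, #|M| = n./2
      & cover M \subset [set: 'I_n]].
  by apply: matching_exists; rewrite cardsT card_ord; lia.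
have mM : maximum_matching M.
  by apply/and3P; split; [apply/'forall_in_eqP | | rewrite cM card_ord].
have [T tT] := tournament_exists M.
have sk := tournament_system_skeleton mM tT.
have tsF : triple_system (tournament_system M T).
  by apply/'forall_in_eqP; case: sk.
have <- : #|tournament_system M T| = (n.-1 ^ 2) %/ 4.
  by apply/eqP; have [_] := skeleton_card_leqif sk; rewrite card_ord mM.
apply: (@leq_bigmax_cond _ _ (fun F : {set {set 'I_n}} => #|F|)).
by rewrite tsF; apply/(avoids_skeleton tsF); exists M.
Qed.
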